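(* There exist no Pythagorean boxes with a square base which possess a face that is a primitive Pythagorean rectangle. In other words, there is no Pythagorean box characterized by a septuple of the form $(x,x,z,t,s,u,w)$ (i.e. $(x,y,z,t,s,u,w)$ with $x=y$) having a face which is a primitive Pythagorean rectangle. Equivalently, if such a Pythagorean box has a face which is a Pythagorean rectangle, then that face must be nonprimitive.
   Context: A Pythagorean rectangle is a rectangle with integer side lengths and integer diagonal length. It is primitive if the congruent right triangles into which a diagonal cuts it are primitive Pythagorean triangles, i.e. its two side lengths are coprime. A Pythagorean box (PB) is a three-dimensional rectangular box (rectangular parallelepiped) whose edge lengths and inner (space) diagonal length are positive integers. It is characterized by the septuple $(x,y,z,t,s,u,w)$, where $x,y,z$ are the (positive integer) edge lengths, $t$ is the (positive integer) inner diagonal length, so that $x^2+y^2+z^2=t^2$, and $s,u,w$ are the (positive real, not necessarily integer) lengths of the face diagonals, with $s^2 = x^2+y^2$, $u^2=y^2+z^2$, $w^2=x^2+z^2$. The three pairs of opposite congruent faces are characterized by the triples (side, side, diagonal) $(x,z,w)$, $(x,y,s)$ and $(y,z,u)$. The base is the face with sides $x$ and $y$. *)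

(* Defs.v *)
From mathcomp Require Import all_boot all_order all_algebra.
From mathcomp Require Import reals.

Set Implicit Arguments.
Unset Strict Implicit.
Unset Printing Implicit Defensive.

Import Order.TTheory GRing.Theory Num.Theory.
Local Open Scope ring_scope.

(* Edges and inner diagonal are natural numbers; the face diagonals [s], [u],
   [w] are only real, since they need not be integers. *)
Record pythagorean_box (R : realType) (x y z t : nat) (s u w : R) : Prop :=
  PythagoreanBox {
    pbox_x_gt0 : (0 < x)%N;
    pbox_y_gt0 : (0 < y)%N;
    pbox_z_gt0 : (0 < z)%N;
    pbox_t_gt0 : (0 < t)%N;
    pbox_s_gt0 : 0 < s;
    pbox_u_gt0 : 0 < u;
    pbox_w_gt0 : 0 < w;
    pbox_inner : (x ^ 2 + y ^ 2 + z ^ 2 = t ^ 2)%N;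
    pbox_xy : s ^+ 2 = x%:R ^+ 2 + y%:R ^+ 2;
    pbox_yz : u ^+ 2 = y%:R ^+ 2 + z%:R ^+ 2;
    pbox_xz : w ^+ 2 = x%:R ^+ 2 + z%:R ^+ 2
  }.

(* One (side, side, diagonal) triple per pair of opposite faces; the base is
   [(x, y, s)]. *)
Definition faces (R : realType) (x y z : nat) (s u w : R) :
    seq (nat * nat * R) :=
  [:: (x, z, w); (x, y, s); (y, z, u)].

Definition pythagorean_rectangle (R : realType) (f : nat * nat * R) : Prop :=
  let: (a, b, d) := f in
  [/\ (0 < a)%N, (0 < b)%N, 0 < d, d ^+ 2 = a%:R ^+ 2 + b%:R ^+ 2
    & exists n : nat, d = n%:R].

Definition primitive_pythagorean_rectangle (R : realType)
    (f : nat * nat * R) : Prop :=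
  pythagorean_rectangle f /\ coprime f.1.1 f.1.2.

(* Main.v *)
Require Import Defs.
From mathcomp Require Import all_boot all_order all_algebra.
From mathcomp Require Import reals.
From mathcomp Require Import zify.

Set Implicit Arguments.
Unset Strict Implicit.
Unset Printing Implicit Defensive.

(** A primitive face on the square base would give x = 1 and s^2 = 2.  For the
    other faces, w^2 = z^2 + x^2 and t^2 = w^2 + x^2, so z^2, w^2, t^2 is an
    arithmetic progression whose common difference is a square, with x and w
    coprime.  Fermat's descent excludes this: with p = (t + z) / 2 and
    q = (t - z) / 2 one has p^2 + q^2 = w^2 and 2 p q = x^2, so {p, q} is
    {2 a^2, b^2} and 4 a^4 + b^4 = w^2; parametrizing this triple gives
    b^2 = e^4 - f^4 with e < w, and then e^2 - f^2, e^2, e^2 + f^2 is again such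
    a progression. *)

(** The root is [gcdn a c]: its square divides gcd(a^2, c^2) = gcd(a^2, ab) = a gcd(a, b) = a, and
    conversely [a] divides a^2, ac and c^2 = ab. *)
Lemma coprime_sqr_factor a b c :
  coprime a b -> a * b = c ^ 2 -> exists d, a = d ^ 2.
Proof.
move=> cab abc; exists (gcdn a c); apply/eqP.
rewrite eqn_dvd; apply/andP; split.
  rewrite -mulnn muln_gcdl !muln_gcdr !dvdn_gcd dvdn_mulr //=.
  by rewrite dvdn_mulr //= dvdn_mull //= mulnn -abc dvdn_mulr.
have ea : gcdn (a ^ 2) (c ^ 2) = a.
  by rewrite -abc -mulnn -muln_gcdr (eqP cab) muln1.
by rewrite -[X in _ %| X]ea dvdn_gcd !dvdn_exp2r ?dvdn_gcdl ?dvdn_gcdr.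
Qed.

Lemma coprime_sqr_factors a b c :
  coprime a b -> a * b = c ^ 2 -> exists d e, [/\ a = d ^ 2, b = e ^ 2 & d * e = c].
Proof.
move=> cab abc; have [d ad] := coprime_sqr_factor cab abc.
have [e be] : exists e, b = e ^ 2.
  by apply: (@coprime_sqr_factor b a c); rewrite 1?coprime_sym // mulnC.
exists d, e; split=> //; apply/eqP.
by rewrite -(eqn_exp2r _ _ (isT : 0 < 2)) expnMn -ad -be abc.
Qed.

Lemma coprime_of_dvd a b :
  (forall d, d %| a -> d %| b -> d = 1) -> coprime a b.
Proof. by move=> h; apply/eqP/h; rewrite (dvdn_gcdl, dvdn_gcdr). Qed.

Lemma coprime_dvd_eq1 a b d : coprime a b -> d %| a -> d %| b -> d = 1.
Proof.
by move=> /eqP cab da db; apply/eqP; rewrite -dvdn1 -cab dvdn_gcd da.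
Qed.

(** Two odd squares add up to 2 modulo 4, which is not a square. For odd [x] this refutes the first
    equation if [w] is odd, and the second if [w] is even, since [z] is then odd. *)
Lemma square_progression_parity x w t z :
    coprime x w -> w ^ 2 + x ^ 2 = t ^ 2 -> z ^ 2 + x ^ 2 = w ^ 2 ->
  [/\ ~~ odd x, odd w, odd t & odd z].
Proof.
move=> cxw; have nboth : odd x || odd w.
  apply: contraT; rewrite negb_or -!dvdn2 => /andP[x2 w2].
  by have := coprime_dvd_eq1 cxw x2 w2.
move: nboth (odd_double_half x) (odd_double_half w) (odd_double_half t)
  (odd_double_half z); rewrite -!mul2n.
by case: (odd x); case: (odd w); case: (odd t); case: (odd z) => //= _; nia.
Qed.

(* The half-sum [p] and half-difference [q] of [t] and [z]. *)
Lemma square_progression_legs x w t z :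
    0 < x -> coprime x w -> w ^ 2 + x ^ 2 = t ^ 2 -> z ^ 2 + x ^ 2 = w ^ 2 ->
  exists p q y, [/\ 0 < y, p ^ 2 + q ^ 2 = w ^ 2, p * q = 2 * y ^ 2,
    coprime p q & odd w].
Proof.
move=> x0 cxw h1 h2; have [xe wo tO zo] := square_progression_parity cxw h1 h2.
have zt : z <= t by rewrite -(leq_exp2r _ _ (isT : 0 < 2)); lia.
have tz : ~~ odd (t - z) by rewrite oddB // tO zo.
(* From 4pq = t^2 - z^2 = 2x^2 and x = 2y follows pq = 2y^2. *)
exists (z + (t - z)./2), (t - z)./2, x./2.
have := odd_double_half x; rewrite (negPf xe) add0n -mul2n => ex.
have := odd_double_half (t - z); rewrite (negPf tz) add0n -mul2n => et.
move: x./2 (t - z)./2 ex et => y q ex et.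
have tE : t = z + 2 * q by lia.
subst t; have e1 : (z + q) ^ 2 + q ^ 2 = w ^ 2 by nia.
have e2 : (z + q) * q = 2 * y ^ 2 by nia.
split=> //; first by lia.
apply: coprime_of_dvd => d dp dq; apply: (coprime_dvd_eq1 cxw).
  rewrite -(@dvdn_pexp2r _ _ 2) //.
  have -> : x ^ 2 = 2 * ((z + q) * q) by rewrite e2 -ex expnMn mulnA.
  by rewrite dvdn_mull // -mulnn dvdn_mul.
by rewrite -(@dvdn_pexp2r _ _ 2) // -e1 dvdn_add // dvdn_exp2r.
Qed.

Lemma square_progression_quartic x w t z :
    0 < x -> coprime x w -> w ^ 2 + x ^ 2 = t ^ 2 -> z ^ 2 + x ^ 2 = w ^ 2 ->
  exists a b, [/\ 0 < a, odd b, coprime a b & 4 * a ^ 4 + b ^ 4 = w ^ 2].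
Proof.
move=> x0 cxw h1 h2.
have [p [q [y [y0 e1 e2 cpq wo]]]] := square_progression_legs x0 cxw h1 h2.
(* The product of [p] and [q] is even and their roles are symmetric. *)
wlog pe : p q e1 e2 cpq / ~~ odd p => [IH|].
  have [po|] := boolP (odd p); last exact: (IH p q).
  apply: (IH q p); rewrite 1?addnC 1?mulnC 1?coprime_sym //.
  by have := congr1 odd e2; rewrite !oddM po /= => ->.
have := odd_double_half p; rewrite (negPf pe) add0n -mul2n => ep.
rewrite -ep in e1 e2 cpq.
have cq : coprime p./2 q by move: cpq; rewrite coprimeMl => /andP[].
have qo : odd q by move: cpq; rewrite coprimeMl coprime2n => /andP[].
have [a [b [ea eb ab]]] : exists a b, [/\ p./2 = a ^ 2, q = b ^ 2 & a * b = y].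
  by apply: coprime_sqr_factors => //; lia.
exists a, b; split.
- by move: y0; rewrite -ab muln_gt0 => /andP[].
- by move: qo; rewrite eb oddX.
- by move: cq; rewrite ea eb coprime_pexpl // coprime_pexpr.
- by rewrite -e1 ea eb; lia.
Qed.

(** With h = (w - b^2)/2 the equation becomes h(h + b^2) = a^4. The two factors are coprime, so
    taking square roots twice makes them the fourth powers f^4 and e^4. *)
Lemma quartic_descent a b w :
    0 < a -> odd b -> coprime a b -> 4 * a ^ 4 + b ^ 4 = w ^ 2 ->
  exists e f, [/\ 0 < f, e < w, coprime f e & f ^ 4 + b ^ 2 = e ^ 4].
Proof.
move=> a0 bo cab ew.
have wo : odd w.
  have := congr1 odd ew; rewrite oddD oddM !oddX bo /=.
  by case: (odd w).
have bw : b ^ 2 <= w by rewrite -(leq_exp2r _ _ (isT : 0 < 2)) -expnM -ew leq_addl.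
have := odd_double_half (w - b ^ 2).
rewrite oddB // oddX bo wo add0n -mul2n; set h := _./2 => eh.
have wE : w = b ^ 2 + 2 * h by lia.
have e1 : h * (h + b ^ 2) = (a ^ 2) ^ 2.
  by move: ew; rewrite wE -!expnM; nia.
have ch : coprime h (h + b ^ 2).
  apply: coprime_of_dvd => d dh; rewrite dvdn_addr // => db.
  apply: (@coprime_dvd_eq1 (a ^ 4) (b ^ 2)) => //.
    by rewrite coprime_pexpl // coprime_pexpr.
  by rewrite (expnM a 2 2) -e1 dvdn_mulr.
have [n [m [hn hm nm]]] := coprime_sqr_factors ch e1.
have cnm : coprime n m.
  by move: ch; rewrite hm hn coprime_pexpl // coprime_pexpr.
have [f [e [nf me fe]]] := coprime_sqr_factors cnm nm.
have /andP[f0 e0] : (0 < f) && (0 < e) by rewrite -muln_gt0 fe.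
exists e, f; split=> //.
(* The descent is strict: e <= e^4 = h + b^2 < 2h + b^2 = w, because h > 0. *)
- have em : e <= m ^ 2 by rewrite me -expnM -{1}(expn1 e) leq_pexp2l.
  have h0 : 0 < h by rewrite hn nf !expn_gt0 f0.
  by lia.
- by move: cnm; rewrite nf me coprime_pexpl // coprime_pexpr.
- by rewrite (expnM f 2 2) (expnM e 2 2) -nf -me -hn -hm.
Qed.

Lemma quartic_difference_progression e f b :
    odd b -> coprime f e -> f ^ 4 + b ^ 2 = e ^ 4 ->
  exists t z, e ^ 2 + f ^ 2 = t ^ 2 /\ z ^ 2 + f ^ 2 = e ^ 2.
Proof.
move=> bo cfe eb.
have fe : f ^ 2 <= e ^ 2.
  by rewrite -(leq_exp2r _ _ (isT : 0 < 2)) -!expnM -eb leq_addr.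
have e1 : (e ^ 2 - f ^ 2) * (e ^ 2 + f ^ 2) = b ^ 2.
  by rewrite -subn_sqr -!expnM -eb addKn.
(* A common divisor divides 2e^2 and 2f^2; it is odd because it divides b^2, so the factor 2
   cancels. *)
have c : coprime (e ^ 2 - f ^ 2) (e ^ 2 + f ^ 2).
  apply: coprime_of_dvd => d dm dp.
  have d2 : coprime d 2.
    rewrite coprimen2; apply: (@dvdn_odd _ (b ^ 2)); last by rewrite oddX.
    by rewrite -e1 dvdn_mulr.
  apply: (@coprime_dvd_eq1 (f ^ 2) (e ^ 2)).
  - by rewrite coprime_pexpl // coprime_pexpr.
  - rewrite -(Gauss_dvdr _ d2).
    have -> : 2 * f ^ 2 = (e ^ 2 + f ^ 2) - (e ^ 2 - f ^ 2) by lia.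
    by rewrite dvdn_sub.
  - rewrite -(Gauss_dvdr _ d2).
    have -> : 2 * e ^ 2 = (e ^ 2 + f ^ 2) + (e ^ 2 - f ^ 2) by lia.
    by rewrite dvdn_add.
have [z [t [hz ht _]]] := coprime_sqr_factors c e1.
by exists t, z; split=> //; lia.
Qed.

(** Infinite descent on [w], the root of the middle term: the pair (x, w) is replaced by (f, e) with
    e < w. *)
Lemma no_square_progression x w t z :
    0 < x -> coprime x w -> w ^ 2 + x ^ 2 = t ^ 2 -> z ^ 2 + x ^ 2 <> w ^ 2.
Proof.
elim/ltn_ind: w x t z => w IH x t z x0 cxw h1 h2.
have [a [b [a0 bo cab ew]]] := square_progression_quartic x0 cxw h1 h2.
have [e [f [f0 ltew cfe ef]]] := quartic_descent a0 bo cab ew.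
have [t' [z' [h1' h2']]] := quartic_difference_progression bo cfe ef.
exact: IH ltew f t' z' f0 cfe h1' h2'.
Qed.

Lemma pythagorean_rectangle_nat (R : realType) (a b : nat) (d : R) :
  pythagorean_rectangle (a, b, d) -> exists n, n ^ 2 = a ^ 2 + b ^ 2.
Proof.
case=> _ _ _ dab [n dn]; exists n; apply/eqP.
by rewrite -(Num.Theory.eqr_nat R) GRing.natrD !GRing.natrX -dn; apply/eqP.
Qed.

Lemma square_base_no_primitive_face (R : realType) x z t (s u w : R) f :
    pythagorean_box x x z t s u w -> f \in faces x x z s u w ->
  ~ primitive_pythagorean_rectangle f.
Proof.
case=> x0 _ _ _ _ _ _ inner _ _ _ fin [].
(* As the base is square, this one claim serves both kinds of lateral face. A common divisor of [x]
   and [n] also divides [z], so coprimality passes from (x, z) to (x, n). *)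
have side n : n ^ 2 = x ^ 2 + z ^ 2 -> ~~ coprime x z.
  move=> en; apply/negP => cxz.
  apply: (@no_square_progression x n t z) => //; try lia.
  apply: coprime_of_dvd => d dx dn; apply: (coprime_dvd_eq1 cxz dx).
  rewrite -(@dvdn_pexp2r _ _ 2) // -(@dvdn_addr (x ^ 2)) ?dvdn_exp2r //.
  by rewrite -en dvdn_exp2r.
move: fin; rewrite !inE => /or3P[] /eqP-> /pythagorean_rectangle_nat[n en] /=.
- exact/negP/(side n).
- rewrite /coprime gcdnn => /eqP x1; move: en; rewrite x1.
  by case: n => [|[|n]] //; nia.
- exact/negP/(side n).
Qed.

Theorem mainTheorem3 (R : realType) :
  (~ exists (x y z t : nat) (s u w : R),
       [/\ pythagorean_box x y z t s u w,
           x = y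
         & exists2 f, f \in faces x y z s u w
                    & primitive_pythagorean_rectangle f])
  /\
  (forall (x z t : nat) (s u w : R),
     pythagorean_box x x z t s u w ->
     forall f, f \in faces x x z s u w ->
       pythagorean_rectangle f -> ~ primitive_pythagorean_rectangle f).
Proof.
split=> [[x [y [z [t [s [u [w [box xy [f fin prim]]]]]]]]]|].
  by subst y; exact: square_base_no_primitive_face box fin prim.
by move=> x z t s u w box f fin _; exact: square_base_no_primitive_face box fin.
Qed.
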